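(* Let $r\ge2$, let $\bm{\mu}=(\mu_1,\dots,\mu_r)\in\mathcal{L}^r$ be a perfect system with $\mu_j\in\mathcal{L}_{N_j}$, $N_j\le\infty$, and $\mu_r\in\mathcal{L}_m$ with $m=N_r<\infty$. Let $\bm{\nu}=(\mu_1,\dots,\mu_{r-1})$, let $\Phi$ be the monic orthogonal polynomial of degree $m$ of $\mu_r$, and let $\widehat{\bm{\nu}}=(\Phi\mu_1,\dots,\Phi\mu_{r-1})$. Then the nearest neighbour recurrence coefficients of $\widehat{\bm{\nu}}$ can be computed from the recurrence coefficients of $\bm{\nu}$ (together with the Jacobi coefficients of $\mu_r$) using the CC algorithm applied to $\bm{\mu}$. That is: starting from the Jacobi coefficients $\{a_{n\bm{e}_j,j}\}_{n=1}^{N_j}$, $\{b_{n\bm{e}_j,j}\}_{n=0}^{N_j-1}$ of $\mu_j$, $1\le j\le r$, the CC algorithm described in the context never divides by zero, and its output $a_{\bm{n},j}$ ($\bm{n}\in\mathbb{N}^r_{\bm{N}}$), $b_{\bm{n},j}$ ($\bm{n}\in\mathbb{N}^r_{\bm{N}-\bm{e}_j}$) satisfies, for $1\le j\le r-1$, $$\widehat a_{\bm{k},j}=a_{(\bm{k},m),j}\ \ (\bm{k}\in\mathbb{N}^{r-1}_{\bm{K}}),\qquad \widehat b_{\bm{k},j}=b_{(\bm{k},m),j}\ \ (\bm{k}\in\mathbb{N}^{r-1}_{\bm{K}-\bm{e}_j}),$$ where $\bm{N}=(N_1,\dots,N_r)$, $\bm{K}=(N_1,\dots,N_{r-1})$ and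 $\widehat a_{\bm{k},j},\widehat b_{\bm{k},j}$ are the nearest neighbour recurrence coefficients of $\widehat{\bm{\nu}}$.
   Context: $\mathbb{N}=\{0,1,2,\dots\}$; $\bm{e}_j$ are the standard unit vectors. A moment functional is a linear map $\mu:\mathbb{C}[x]\to\mathbb{C}$; put $\Delta_n=\det(\mu[x^{i+k}])_{i,k=0}^{n-1}$. For $N\in\{1,2,\dots\}$, $\mathcal{L}_N$ is the set of $\mu$ with $\Delta_n\ne0$ for $1\le n\le N$ and $\Delta_n=0$ for $n>N$; $\mathcal{L}_\infty$ is the set of $\mu$ with $\Delta_n\neq0$ for all $n$; $\mathcal{L}=\mathcal{L}_\infty\cup\bigcup_{N\ge1}\mathcal{L}_N$. For $\mu\in\mathcal{L}_N$ the monic orthogonal polynomials $P_n$, $0\le n\le N$ (finite $n$) satisfy $xP_n=P_{n+1}+b_nP_n+a_nP_{n-1}$ for $0\le n\le N-1$ ($a_0=0$); $a_n,b_n$ are the Jacobi coefficients of $\mu$, and one sets $a_N=0$ if $N<\infty$. The Jacobi coefficients of $\mu_j$ are written $a_{n\bm{e}_j,j},b_{n\bm{e}_j,j}$. $\Phi\mu$ is the functional $f\mapsto\mu[\Phi f]$. For a system $(\mu_1,\dots,\mu_s)$ of moment functionals and $\bm{n}\in\mathbb{N}^s$, $|\bm{n}|=\sum n_j$, a type II polynomial at $\bm{n}$ is a nonzero polynomial $P$ with $\deg P\le|\bm{n}|$ and $\mu_j[P(x)x^p]=0$ for $0\le p\le n_j-1$, $1\le j\le s$. The index $\bm{n}$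 is normal if every such $P$ has degree exactly $|\bm{n}|$; then $P_{\bm{n}}$ is the unique monic one. $\mathbb{N}^s_{\bm{M}}=\{\bm{n}\in\mathbb{N}^s:n_j\le M_j\ \forall j\}$. A system with $\mu_j\in\mathcal{L}_{N_j}$ is perfect if all indices in $\mathbb{N}^s_{\bm{N}}$ are normal. (If $\bm{\mu}$ is perfect, all indices $\bm{k}\in\mathbb{N}^{r-1}_{\bm{K}}$ are normal for $\widehat{\bm{\nu}}$.) The nearest neighbour recurrence coefficients are defined by $xP_{\bm{n}}=P_{\bm{n}+\bm{e}_j}+b_{\bm{n},j}P_{\bm{n}}+\sum_{i}a_{\bm{n},i}P_{\bm{n}-\bm{e}_i}$ (for $\bm{n},\bm{n}+\bm{e}_j$ normal), with $a_{\bm{n},i}=0$ if $n_i=0$; they are defined by this for all $a_{\bm{n},j}$ with $\bm{n}\in\mathbb{N}^s_{\bm{N}}$, except that when all $N_j<\infty$ one sets $a_{\bm{N},j}=0$ (and similarly $\widehat a_{\bm{K},j}=0$ for $\widehat{\bm\nu}$ when $N_1,\dots,N_{r-1}<\infty$). CC algorithm (for $\bm{\mu}$, given the Jacobi coefficients of all $\mu_j$). Write $\delta_{\bm{n},j,k}:=b_{\bm{n},k}-b_{\bm{n},j}$ for $\bm{n}\in\mathbb{N}^r_{\bm{N}-\bm{e}_j-\bm{e}_k}$, $j\ne k$. Set $a_{\bm{n},j}=0$ whenever $n_j=0$. For $d=0,1,2,\dots$ successively: (1) for all $j\neq k$ and all $\bm{n}\in\mathbb{N}^r_{\bm{N}}$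 with $n_j,n_k>0$, $|\bm{n}|=d$: $a_{\bm{n},j}=0$ if $a_{\bm{n}-\bm{e}_k,j}=0$, and otherwise $a_{\bm{n},j}=a_{\bm{n}-\bm{e}_k,j}\,\delta_{\bm{n}-\bm{e}_k,k,j}/\delta_{\bm{n}-\bm{e}_k-\bm{e}_j,k,j}$; (2) for all $j\ne k$ and all $\bm{n}\in\mathbb{N}^r_{\bm{N}-\bm{e}_j}$ with $n_k>0$, $|\bm{n}|=d$: $b_{\bm{n},j}=b_{\bm{n}-\bm{e}_k,j}+\big(\sum_{i=1}^ra_{\bm{n},i}-\sum_{i=1}^ra_{\bm{n}+\bm{e}_j-\bm{e}_k,i}\big)/\delta_{\bm{n}-\bm{e}_k,j,k}$; (3) compute all $\delta_{\bm{n},j,k}$ with $|\bm{n}|=d$. (Different admissible $k$ give the same value.) *)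

(* Defs.v *)
From HB Require Import structures.
From mathcomp Require Import all_boot all_order all_algebra.
From mathcomp Require Import boolp classical_sets reals.
From mathcomp Require Import complex.
Set Implicit Arguments.
Unset Strict Implicit.
Unset Printing Implicit Defensive.
Import GRing.Theory.
Local Open Scope ring_scope.

(* Bounds N in {0, 1, 2, ...} together with infinity: None stands for infinity. *)
Definition bound := option nat.

Definition leb_bound (n : nat) (N : bound) : bool :=
  if N is Some M then (n <= M)%N else true.

Section Functionals.
Variable F : fieldType.

Definition hankel (mu : {scalar {poly F}}) (n : nat) : F :=
  \det (\matrix_(i < n, k < n) mu 'X^(i + k)).

Definition in_calL (mu : {scalar {poly F}}) (N : bound) : Prop :=
  match N with
  | Some M => [/\ (0 < M)%N,
                  forall n, (1 <= n <= M)%N -> hankel mu n != 0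
                & forall n, (M < n)%N -> hankel mu n = 0]
  | None => forall n, hankel mu n != 0
  end.

Definition is_monic_op (mu : {scalar {poly F}}) (n : nat) (P : {poly F}) : Prop :=
  [/\ P \is monic, size P = n.+1
    & forall p, (p < n)%N -> mu (P * 'X^p) = 0].

(* The value is meaningful when mu is in calL_N and n <= N: there is then a
   unique such polynomial. *)
Definition monic_op (mu : {scalar {poly F}}) (n : nat) : {poly F} :=
  xget 0 [set P | is_monic_op mu n P].

(* For n = 0 the term P_(n-1) is multiplied by a 0 = 0. *)
Definition jacobi_coeffs (mu : {scalar {poly F}}) (N : bound) (a b : nat -> F)
    : Prop :=
  [/\ a 0%N = 0,
      forall n, N = Some n -> a n = 0
    & forall n, leb_bound n.+1 N ->
        'X * monic_op mu n =
          monic_op mu n.+1 + b n *: monic_op mu n + a n *: monic_op mu n.-1].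

Definition mul_functional (Phi : {poly F}) (mu : {scalar {poly F}})
    : {poly F} -> F := fun f => mu (Phi * f).

Fact mul_functional_is_scalar Phi mu : scalar (mul_functional Phi mu).
Proof.
by move=> c f g; rewrite /mul_functional mulrDr -scalerAr linearP.
Qed.

HB.instance Definition _ Phi mu :=
  GRing.isLinear.Build F {poly F} F *%R (mul_functional Phi mu)
    (mul_functional_is_scalar Phi mu).

End Functionals.

Section MultiIndices.
Variable s : nat.

Definition mindex := {ffun 'I_s -> nat}.

Definition weight (n : mindex) : nat := (\sum_i n i)%N.

Definition incr (n : mindex) (j : 'I_s) : mindex :=
  [ffun i => (n i + (i == j))%N].

(* n - e_j; truncated, hence only meaningful when 0 < n j. *)
Definition decr (n : mindex) (j : 'I_s) : mindex :=
  [ffun i => (n i - (i == j))%N].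

(* Membership in NN^s_N. Membership of n in NN^s_(N - e_j) is expressed as
   [inbox N (incr n j)], which also makes sense when N j is infinite. *)
Definition inbox (N : 'I_s -> bound) (n : mindex) : bool :=
  [forall j, leb_bound (n j) (N j)].

End MultiIndices.

(* The multi-index (k, m), with m in the last position. *)
Definition mi_rcons (s : nat) (k : mindex s) (m : nat) : mindex s.+1 :=
  [ffun i => if unlift ord_max i is Some j then k j else m].

Section TypeII.
Variables (F : fieldType) (s : nat).
Implicit Types (mu : 'I_s -> {scalar {poly F}}) (n : mindex s).

Definition typeII mu n (P : {poly F}) : Prop :=
  [/\ P != 0, (size P <= (weight n).+1)%N
    & forall (j : 'I_s) (p : nat), (p < n j)%N -> mu j (P * 'X^p) = 0].

Definition normal_index mu n : Prop :=
  forall P, typeII mu n P -> size P = (weight n).+1.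

(* The unique monic type II polynomial P_n when n is normal. *)
Definition mop mu n : {poly F} :=
  xget 0 [set P | typeII mu n P /\ P \is monic].

Definition perfect mu (N : 'I_s -> bound) : Prop :=
  (forall j, in_calL (mu j) (N j)) /\
  (forall n, inbox N n -> normal_index mu n).

(* a and b are the nearest neighbour recurrence coefficients of mu over the
   box NN^s_N, all of whose indices are required to be normal. The values
   a n j for n in NN^s_N, and b n j for n in NN^s_(N - e_j), are determined by
   these conditions; the values elsewhere are unconstrained, except for the
   normalization a n j = 0 at the corner n = N when all N j are finite. *)
Definition nn_coeffs mu (N : 'I_s -> bound) (a b : mindex s -> 'I_s -> F)
    : Prop :=
  [/\ forall n, inbox N n -> normal_index mu n,
      forall n j, inbox N n -> n j = 0%N -> a n j = 0,
      forall n, (forall i, N i = Some (n i)) -> forall j, a n j = 0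
    & forall n j, inbox N (incr n j) ->
        'X * mop mu n =
          mop mu (incr n j) + b n j *: mop mu n
          + \sum_(i < s) a n i *: mop mu (decr n i)].

End TypeII.

Section CCAlgorithm.
Variables (F : fieldType) (r : nat).

Definition table := mindex r -> 'I_r -> F.

Definition delta (b : table) (n : mindex r) (j k : 'I_r) : F := b n k - b n j.

Definition off_axis (n : mindex r) (j : 'I_r) : bool :=
  [exists k, (k != j) && (0 < n k)%N].

(* In both steps of a stage the same entry (n, j) is written once for every
   k <> j with n k > 0, and each of these writes only reads entries that this
   step does not modify; hence, whatever the order of the loop, the entry ends
   up with the value computed from one of these k. A selector records which
   one, and different selectors account for all possible orders. *)
Definition selector (sel : mindex r -> 'I_r -> 'I_r) : Prop :=
  forall n j, off_axis n j -> sel n j != j /\ (0 < n (sel n j))%N.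

Variables (N : 'I_r -> bound) (aJ bJ : 'I_r -> nat -> F).
Variables (sela selb : mindex r -> 'I_r -> 'I_r).

Definition cc_init_a : table := fun n j =>
  if (0 < n j)%N && ~~ off_axis n j then aJ j (n j) else 0.

Definition cc_init_b : table := fun n j =>
  if ~~ off_axis n j then bJ j (n j) else 0.

Definition cc_step1 (d : nat) (a b : table) : table := fun n j =>
  if [&& weight n == d, inbox N n, (0 < n j)%N & off_axis n j] then
    let k := sela n j in
    if a (decr n k) j == 0 then 0
    else a (decr n k) j * delta b (decr n k) k j
           / delta b (decr (decr n k) j) k j
  else a n j.

Definition cc_step2 (d : nat) (a b : table) : table := fun n j =>
  if [&& weight n == d, inbox N (incr n j) & off_axis n j] then
    let k := selb n j in
    b (decr n k) j
      + (\sum_(i < r) a n i - \sum_(i < r) a (decr (incr n j) k) i)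
          / delta b (decr n k) j k
  else b n j.

(* The tables after the stages 0, ..., d - 1. The differences delta need not
   be stored, being read off from the table b. *)
Fixpoint cc_tables (d : nat) : table * table :=
  if d is d'.+1 then
    let: (a, b) := cc_tables d' in
    let a' := cc_step1 d' a b in
    (a', cc_step2 d' a' b)
  else (cc_init_a, cc_init_b).

(* The entries at n are final after stage |n|. *)
Definition cc_a : table := fun n j => (cc_tables (weight n).+1).1 n j.
Definition cc_b : table := fun n j => (cc_tables (weight n).+1).2 n j.

(* Division in F is total, so the absence of a division by zero is stated
   separately: all the divisors met in steps (1) and (2), for every
   admissible k, are nonzero. *)
Definition cc_no_div0 : Prop :=
  (forall n j k, j != k -> inbox N n -> (0 < n j)%N -> (0 < n k)%N ->
     cc_a (decr n k) j != 0 -> delta cc_b (decr (decr n k) j) k j != 0) /\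
  (forall n j k, j != k -> inbox N (incr n j) -> (0 < n k)%N ->
     delta cc_b (decr n k) j k != 0).

End CCAlgorithm.

(* Main.v *)
(* A functional in L_m with m finite vanishes on the ideal generated by its
   orthogonal polynomial Phi of degree m, and Phi divides every polynomial
   orthogonal to 1, ..., x^(m-1). Hence the type II polynomials at (k, m) for mu
   are exactly Phi times those at k for nuhat; since the coefficient
   a_((k,m),r) vanishes, dividing the recurrence of mu at (k, m) by Phi gives
   that of nuhat at k. The same rank property shows that a_(n,j) = 0 only when
   n_j is 0 or N_j, which is what the zero test of the CC algorithm needs. Its
   two steps then follow from
     P_(l+e_j) - P_(l+e_k) = (b_(l,k) - b_(l,j)) P_l,
   whose right-hand factor is nonzero by normality of l + e_j + e_k. *)

Require Import Defs.
From HB Require Import structures.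
From mathcomp Require Import all_boot all_order all_algebra.
From mathcomp Require Import boolp classical_sets reals.
From mathcomp Require Import complex.
From mathcomp Require Import zify ring.
Set Implicit Arguments.
Unset Strict Implicit.
Unset Printing Implicit Defensive.
Import GRing.Theory.
Local Open Scope ring_scope.

(** * Moment functionals of finite rank *)

Section LinearForms.
Variable F : fieldType.
Implicit Types (L mu : {scalar {poly F}}) (P Q f : {poly F}).

Lemma scalar_rVpoly L d (v : 'rV[F]_d) :
  L (rVpoly v) = \sum_(i < d) v 0 i * L 'X^i.
Proof.
rewrite /rVpoly poly_def linear_sum; apply: eq_bigr => i _.
by rewrite linearZ /= valK.
Qed.

Lemma scalar_poly L P : L P = \sum_(i < size P) P`_i * L 'X^i.
Proof.
rewrite -[in LHS](coefK P) poly_def linear_sum.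
by apply: eq_bigr => i _; rewrite linearZ.
Qed.

Lemma rVpoly_eq0 d (v : 'rV[F]_d) : (rVpoly v == 0) = (v == 0).
Proof. by rewrite -(inj_eq (can_inj rVpolyK)) linear0. Qed.

(** Dimension count: one more coefficient than there are linear conditions. *)
Lemma exists_common_zero (T : finType) (L : T -> {scalar {poly F}}) :
  exists P, [/\ P != 0, (size P <= #|T|.+1)%N & forall t, L t P = 0].
Proof.
pose A : 'M[F]_(#|T|.+1, #|T|) := \matrix_(i, t) L (enum_val t) 'X^i.
have /rowV0Pn[v /sub_kermxP vA v0] : kermx A != 0.
  by rewrite kermx_eq0 /row_free neq_ltn ltnS rank_leq_col.
exists (rVpoly v); split; rewrite ?rVpoly_eq0 ?size_poly// => t.
transitivity ((v *m A) 0 (enum_rank t)); last by rewrite vA mxE.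
by rewrite mxE scalar_rVpoly; apply: eq_bigr => i _; rewrite mxE enum_rankK.
Qed.

(** A left null vector of the Hankel matrix is the coefficient vector of such a [P]: entry [p] of
    the product is [mu (P * 'X^p)]. *)
Lemma hankel_eq0P mu n :
  hankel mu n = 0 <->
  exists P, [/\ P != 0, (size P <= n)%N
              & forall p, (p < n)%N -> mu (P * 'X^p) = 0].
Proof.
have E (v : 'rV[F]_n) (p : 'I_n) : mu (rVpoly v * 'X^p) =
    (v *m \matrix_(i < n, k < n) mu 'X^(i + k)) 0 p.
  rewrite mxE [_ * 'X^p]mulrC.
  rewrite -[LHS]/(mul_functional 'X^p mu _) scalar_rVpoly.
    by apply: eq_bigr => i _; rewrite mxE /= /mul_functional -exprD addnC.
split=> [/eqP/det0P[v v0 vH]|[P [P0 sP oP]]].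
  exists (rVpoly v); split; rewrite ?rVpoly_eq0 ?size_poly// => p pn.
  by rewrite (E v (Ordinal pn)) vH mxE.
apply/eqP/det0P; exists (poly_rV P).
  by rewrite -rVpoly_eq0 poly_rV_K.
by apply/rowP => p; rewrite -E poly_rV_K// oP// mxE.
Qed.

(* A null vector of the singular Hankel matrix of size p + 1 is a multiple
   Q * Phi, by nonsingularity at size m; testing it against 'X^(p - deg Q)
   yields mu (Phi * 'X^p) = 0 from the lower moments. *)
Lemma calL_last_op mu m Phi : in_calL mu (Some m) -> is_monic_op mu m Phi ->
  forall f, mu (Phi * f) = 0.
Proof.
case=> m0 Hne Heq [Phim sPhi oPhi].
have Phi0 : Phi != 0 by rewrite monic_neq0.
suff oX p : mu (Phi * 'X^p) = 0.
  move=> f; rewrite -[LHS]/(mul_functional Phi mu f) scalar_poly big1// => i _.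
  by rewrite /= /mul_functional oX mulr0.
have [n] := ubnP p; elim: n p => // n IH p; rewrite ltnS => pn.
have [/oPhi//|mp] := ltnP p m.
have IHf f : (size f <= p)%N -> mu (Phi * f) = 0.
  move=> sf; rewrite -[LHS]/(mul_functional Phi mu f) scalar_poly big1// => i _.
  rewrite /= /mul_functional IH ?mulr0//.
  by rewrite (leq_trans _ pn)// (leq_trans _ sf).
have /Heq/hankel_eq0P[V [V0 sV oV]] : (m < p.+1)%N by rewrite ltnS.
pose Q : {poly F} := V %/ Phi; pose S : {poly F} := V %% Phi.
have VE : V = Q * Phi + S by exact: divp_eq.
have sQ : (size Q + m <= p.+1)%N.
  by rewrite size_divp// sPhi /=; have := sV; case: (size V) => *; lia.
have S0 : S = 0.
  apply/eqP/negPn/negP => S0.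
  have /Hne/eqP[] : (0 < m <= m)%N by rewrite m0 leqnn.
  apply/hankel_eq0P; exists S; split => //.
    by rewrite -ltnS -sPhi ltn_modp.
  (* For [i < m] the product [Q * 'X^i] has degree below [p], so by [IHf] the remainder [S] inherits
     the orthogonality of [V]. *)
  move=> i im; have -> : S = V - Phi * Q by rewrite VE; ring.
  rewrite mulrBl linearB /= oV ?(leq_trans im) ?(leq_trans mp)// -mulrA.
  rewrite IHf ?subrr// (leq_trans (size_polyMleq _ _))// size_polyXn.
  by rewrite addnS -ltnS -addnS (leq_trans _ sQ)// leq_add2l.
have Q0 : Q != 0 by apply: contra_neq V0 => Q0; rewrite VE S0 Q0 mul0r addr0.
pose f : {poly F} := Q * 'X^(p - (size Q).-1).
have sf : size f = p.+1.
  by have := Q0; rewrite size_mulXn// -size_poly_gt0; lia.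
have lf : f`_p != 0.
  by rewrite -[p]/(p.+1.-1) -sf -lead_coefE lead_coef_eq0 -size_poly_gt0 sf.
have mf : mu (Phi * f) = 0.
  by rewrite /f mulrA [Phi * Q]mulrC -[Q * Phi]addr0 -S0 -VE oV//; lia.
suff /IHf : (size (f - f`_p *: 'X^p)%R <= p)%N.
  rewrite mulrBr linearB /= -scalerAr linearZ /= mf sub0r => /eqP.
  by rewrite oppr_eq0 mulf_eq0 (negPf lf) => /eqP.
apply/leq_sizeP => i; rewrite leq_eqVlt => /predU1P[<-|pi].
  by rewrite coefB coefZ coefXn eqxx mulr1 subrr.
by rewrite coefB coefZ coefXn gtn_eqF// mulr0 subr0 nth_default// sf.
Qed.

(** The remainder modulo [Phi] differs from [Q] by a multiple of [Phi], which [mu] does not see. It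
    is thus a null vector of the nonsingular Hankel matrix of size [m]. *)
Lemma calL_last_op_dvdp mu m Phi Q : in_calL mu (Some m) ->
  is_monic_op mu m Phi -> (forall p, (p < m)%N -> mu (Q * 'X^p) = 0) ->
  Phi %| Q.
Proof.
move=> hmu hPhi oQ; have [Phim sPhi _] := hPhi.
have [m0 Hne _] := hmu; apply/negPn/negP => S0.
have /Hne/eqP[] : (0 < m <= m)%N by rewrite m0 leqnn.
apply/hankel_eq0P; exists (Q %% Phi); split => //.
  by rewrite -ltnS -sPhi ltn_modp monic_neq0.
move=> i im; have -> : Q %% Phi = Q - Phi * (Q %/ Phi).
  by rewrite {2}(divp_eq Q Phi); ring.
by rewrite mulrBl linearB /= oQ// -mulrA (calL_last_op hmu hPhi) subrr.
Qed.

End LinearForms.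

(** * Boxes and unit steps of multi-indices *)

Lemma leb_bound_leq (n n' : nat) (M : bound) :
  (n <= n')%N -> leb_bound n' M -> leb_bound n M.
Proof. by case: M => //= M; apply: leq_trans. Qed.

Section MultiIndexTheory.
Variables (s : nat) (N : 'I_s -> bound).
Implicit Types (n : mindex s) (i j k : 'I_s).

Lemma weight_incr n j : weight (incr n j) = (weight n).+1.
Proof.
rewrite /weight (eq_bigr (fun i => n i + (i == j))%N) => [|i _]; last first.
  by rewrite ffunE.
by rewrite big_split /= -big_mkcond big_pred1_eq addn1.
Qed.

Lemma decr_incr n j : decr (incr n j) j = n.
Proof. by apply/ffunP => i; rewrite !ffunE addnK. Qed.

Lemma incr_decr n j : (0 < n j)%N -> incr (decr n j) j = n.
Proof.
move=> nj; apply/ffunP => i; rewrite !ffunE subnK//.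
by case: eqP => // ->.
Qed.

Lemma incrC n j k : incr (incr n j) k = incr (incr n k) j.
Proof. by apply/ffunP => i; rewrite !ffunE addnAC. Qed.

Lemma decr_incrC n j k : k != j -> decr (incr n j) k = incr (decr n k) j.
Proof.
move=> kj; apply/ffunP => i; rewrite !ffunE.
by case: (eqVneq i k) => [->|_]; rewrite ?(negPf kj) ?addn0 ?subn0.
Qed.

Lemma incr_id n j : incr n j j = (n j).+1.
Proof. by rewrite ffunE eqxx addn1. Qed.

Lemma incr_neq n j i : i != j -> incr n j i = n i.
Proof. by move=> ij; rewrite ffunE (negPf ij) addn0. Qed.

Lemma decr_id n j : decr n j j = (n j).-1.
Proof. by rewrite ffunE eqxx subn1. Qed.

Lemma decr_neq n j i : i != j -> decr n j i = n i.
Proof. by move=> ij; rewrite ffunE (negPf ij) subn0. Qed.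

Lemma weight_decr n j : (0 < n j)%N -> weight n = (weight (decr n j)).+1.
Proof. by move=> nj; rewrite -(weight_incr _ j) incr_decr. Qed.

Lemma inbox_incrW n j : inbox N (incr n j) -> inbox N n.
Proof.
move=> /forallP h; apply/forallP => i; apply: leb_bound_leq (h i).
by rewrite ffunE leq_addr.
Qed.

Lemma inbox_decr n j : inbox N n -> inbox N (decr n j).
Proof.
move=> /forallP h; apply/forallP => i; apply: leb_bound_leq (h i).
by rewrite ffunE leq_subr.
Qed.

Lemma inbox_incr n j : inbox N n -> N j <> Some (n j) -> inbox N (incr n j).
Proof.
move=> /forallP h nN; apply/forallP => i; have := h i.
have [->|ij] := eqVneq i j; last by rewrite incr_neq.
rewrite incr_id; case: (N j) nN => //= M nN; rewrite leq_eqVlt.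
by move=> /predU1P[E|//]; case: nN; rewrite E.
Qed.

Lemma inbox_corner n : inbox N n ->
  (forall i, N i = Some (n i)) \/ exists j, inbox N (incr n j).
Proof.
move=> nN; have [/forallP h|/forallPn[j h]] :=
  boolP [forall i, N i == Some (n i)]; [left|right].
  by move=> i; apply/eqP.
by exists j; apply: inbox_incr => //; apply/eqP.
Qed.

Lemma weight_on_axis n j : ~~ off_axis n j -> weight n = n j.
Proof.
move=> /existsPn h; rewrite /weight (bigD1 j)//= big1 ?addn0// => i ij.
by apply/eqP; rewrite -leqn0 leqNgt; apply: contra (h i) => ->; rewrite ij.
Qed.

Lemma on_axis_eq0 n j i : ~~ off_axis n j -> i != j -> n i = 0%N.
Proof.
move=> /existsPn h ij; apply/eqP; rewrite -leqn0 leqNgt.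
by apply: contra (h i) => ->; rewrite ij.
Qed.

End MultiIndexTheory.

(** * Type II polynomials and nearest neighbour recurrences *)

Section TypeIITheory.
Variables (F : fieldType) (s : nat) (mu : 'I_s -> {scalar {poly F}}).
Implicit Types (n l : mindex s) (P : {poly F}).

(** The linear part of [typeII], stable under differences and scaling. *)
Definition multi_orth n P :=
  forall (j : 'I_s) (p : nat), (p < n j)%N -> mu j (P * 'X^p) = 0.

(** The form in which normality is used: polynomial identities follow by applying this to the
    difference of their sides. *)
Lemma normal_index_eq0 n P : normal_index mu n -> (size P <= weight n)%N ->
  multi_orth n P -> P = 0.
Proof.
move=> nn sP oP; apply/eqP/negPn/negP => P0.
have : typeII mu n P by split => //; rewrite ltnW.
by move/nn => E; rewrite E ltnn in sP.
Qed.

Lemma multi_orthB n P Q : multi_orth n P -> multi_orth n Q ->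
  multi_orth n (P - Q).
Proof.
by move=> oP oQ j p pn; rewrite mulrBl linearB /= oP// oQ// subrr.
Qed.

Lemma multi_orthZ n c P : multi_orth n P -> multi_orth n (c *: P).
Proof.
by move=> oP j p pn; rewrite -scalerAl linearZ /= oP// mulr0.
Qed.

Lemma exists_typeII n : exists P, typeII mu n P.
Proof.
(* The pairs (j, p) with p < n_j index the |n| orthogonality conditions. *)
pose T := {j : 'I_s & 'I_(n j)}.
pose L (t : T) := mul_functional 'X^(tagged t) (mu (tag t)) : {scalar {poly F}}.
have cT : #|{: T}| = weight n.
  rewrite card_tagged sumnE big_map big_enum /=.
  by apply: eq_bigr => j _; rewrite card_ord.
have [P [P0 sP oP]] := exists_common_zero L.
exists P; split=> //; first by rewrite -cT.
move=> j p pn; rewrite mulrC.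
exact: oP (Tagged (fun j => 'I_(n j)) (Ordinal pn)).
Qed.

Lemma monic_sub_size P Q d : P \is monic -> Q \is monic ->
  size P = d.+1 -> size Q = d.+1 -> (size (P - Q)%R <= d)%N.
Proof.
move=> /monicP mP /monicP mQ sP sQ; apply/leq_sizeP => i.
rewrite coefB leq_eqVlt => /predU1P[<-|di].
  by move: mP mQ; rewrite !lead_coefE sP sQ /= => -> ->; rewrite subrr.
by rewrite !nth_default ?subrr ?sP ?sQ.
Qed.

(** Dividing any type II polynomial by its leading coefficient shows that [xget] chooses from an
    inhabited set, so [mop] is not the default 0. *)
Lemma mopP n : normal_index mu n ->
  [/\ mop mu n \is monic, size (mop mu n) = (weight n).+1
    & multi_orth n (mop mu n)].
Proof.
move=> nn; have [P tP] := exists_typeII n; have [P0 sP oP] := tP.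
have : [set P | typeII mu n P /\ P \is monic]%classic (mop mu n).
  apply: xgetPex; exists ((lead_coef P)^-1 *: P); split.
    split; first by rewrite scaler_eq0 invr_eq0 lead_coef_eq0 (negPf P0).
      by rewrite size_scale ?invr_eq0 ?lead_coef_eq0.
    exact: multi_orthZ.
  by rewrite monicE lead_coefZ mulVf ?lead_coef_eq0.
by move=> /= [/[dup] /nn sm [_ _ om] mm].
Qed.

Lemma mop_unique n P : normal_index mu n -> P \is monic ->
  size P = (weight n).+1 -> multi_orth n P -> mop mu n = P.
Proof.
move=> nn mP sP oP; have [m1 s1 o1] := mopP nn.
apply/eqP; rewrite -subr_eq0; apply/eqP/(normal_index_eq0 nn).
  exact: monic_sub_size.
exact: multi_orthB.
Qed.

Lemma coef_mop_lead n : normal_index mu n -> (mop mu n)`_(weight n) = 1.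
Proof. by move=> /mopP[/monicP + sm _]; rewrite lead_coefE sm. Qed.

(** Were this moment zero, P_n would be orthogonal at n + e_j with degree only |n|. *)
Lemma mop_moment_neq0 n j : normal_index mu n -> normal_index mu (incr n j) ->
  mu j (mop mu n * 'X^(n j)) != 0.
Proof.
move=> nn nnj; have [mm sm om] := mopP nn.
apply: contraTneq (monic_neq0 mm) => e.
rewrite negbK; apply/eqP/(normal_index_eq0 nnj).
  by rewrite sm weight_incr.
move=> i p; have [->|ij] := eqVneq i j; last first.
  by rewrite incr_neq// => /om.
by rewrite incr_id ltnS leq_eqVlt => /predU1P[->|/om].
Qed.

(* The candidate coefficients: pairing the recurrence with mu_j and
   x^(n_j - 1) forces nn_a, comparing coefficients of x^|n| forces nn_b. *)
Definition nn_a : table F s := fun n j =>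
  if n j == 0%N then 0 else
  mu j (mop mu n * 'X^(n j)) / mu j (mop mu (decr n j) * 'X^((n j).-1)).

Definition nn_b : table F s := fun n j =>
  ('X * mop mu n)`_(weight n) - (mop mu (incr n j))`_(weight n).

(** * Recurrence coefficients over a box of normal indices *)

Section Box.
Variable N : 'I_s -> bound.
Hypothesis norm : forall n, inbox N n -> normal_index mu n.

Lemma mop_orth n : inbox N n -> multi_orth n (mop mu n).
Proof. by move=> /norm/mopP[]. Qed.

Lemma size_mop n : inbox N n -> size (mop mu n) = (weight n).+1.
Proof. by move=> /norm/mopP[]. Qed.

Lemma coef_mop n : inbox N n -> (mop mu n)`_(weight n) = 1.
Proof. by move=> /norm/coef_mop_lead. Qed.

Lemma mop_moment_decr_neq0 n j : inbox N n -> (0 < n j)%N ->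
  mu j (mop mu (decr n j) * 'X^((n j).-1)) != 0.
Proof.
move=> nN nj; rewrite -(decr_id n j); apply: mop_moment_neq0.
  exact/norm/inbox_decr.
by rewrite incr_decr//; apply: norm.
Qed.

Lemma moment_nn_a n j : inbox N n -> (0 < n j)%N ->
  nn_a n j * mu j (mop mu (decr n j) * 'X^((n j).-1)) =
  mu j (mop mu n * 'X^(n j)).
Proof.
by move=> nN nj; rewrite /nn_a gtn_eqF// divfK// mop_moment_decr_neq0.
Qed.

(* On the range of p orthogonality kills every term but the i-th one at the last
   power, which is what determines [a n i]. *)
Lemma multi_orth_recurrence_sum (a : table F s) n i p : inbox N n ->
  (forall k, n k = 0%N -> a n k = 0) -> (p < n i)%N ->
  mu i ((\sum_k a n k *: mop mu (decr n k)) * 'X^p) =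
  if p == (n i).-1 then a n i * mu i (mop mu (decr n i) * 'X^((n i).-1)) else 0.
Proof.
move=> nN a0 pn; rewrite mulr_suml linear_sum (bigD1 i)//= big1 ?addr0.
  rewrite -scalerAl linearZ /=; case: eqP => [->//|/eqP pe].
  rewrite mop_orth ?mulr0 ?inbox_decr// decr_id.
  by lia.
move=> k ki; rewrite -scalerAl linearZ /=.
have [/a0->|nk] := posnP (n k); first by rewrite mul0r.
by rewrite mop_orth ?mulr0 ?inbox_decr// decr_neq// eq_sym.
Qed.

Lemma coef_recurrence_sum (a : table F s) n : inbox N n ->
  (forall k, n k = 0%N -> a n k = 0) ->
  (\sum_k a n k *: mop mu (decr n k))`_(weight n) = 0.
Proof.
move=> nN a0; rewrite coef_sum big1// => k _; rewrite coefZ.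
have [/a0->|nk] := posnP (n k); first by rewrite mul0r.
rewrite nth_default ?mulr0// size_mop ?inbox_decr//.
by rewrite [weight n](weight_decr nk).
Qed.

(** The difference of the two sides is orthogonal at [n] and of degree below |n|: monicity cancels
    x^(|n|+1), the choice of [nn_b] cancels x^|n|. Normality makes it zero. *)
Lemma mop_recurrence n j : inbox N (incr n j) ->
  'X * mop mu n = mop mu (incr n j) + nn_b n j *: mop mu n
                  + \sum_i nn_a n i *: mop mu (decr n i).
Proof.
move=> njN; have nN := inbox_incrW njN.
have a0 k : n k = 0%N -> nn_a n k = 0 by rewrite /nn_a => ->; rewrite eqxx.
apply/eqP; rewrite -subr_eq0; apply/eqP/(normal_index_eq0 (norm nN)).
  have sumr i : (weight n < i)%N ->
      (\sum_k nn_a n k *: mop mu (decr n k))`_i = 0.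
    move=> ni; rewrite coef_sum big1// => k _.
    rewrite coefZ nth_default ?mulr0// size_mop ?inbox_decr//.
    apply: leq_ltn_trans ni.
    by rewrite /weight leq_sum// => ? _; rewrite ffunE leq_subr.
  apply/leq_sizeP => i; rewrite leq_eqVlt => /predU1P[<-|ni].
    rewrite coefB !coefD coef_recurrence_sum// coefZ coef_mop//.
    by rewrite /nn_b; ring.
  rewrite coefB !coefD coefZ sumr// [(mop mu n)`_i]nth_default ?size_mop//.
  move: ni; rewrite mulr0 !addr0 coefXM leq_eqVlt => /predU1P[<-|] /=.
    by rewrite coef_mop// -(weight_incr n j) coef_mop// subrr.
  by case: i => // i ni; rewrite !nth_default ?subrr ?size_mop ?weight_incr.
move=> i p pn; rewrite mulrBl !mulrDl linearB !linearD /=.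
rewrite -scalerAl linearZ /= mop_orth// ?mop_orth//; last first.
  by rewrite ffunE ltn_addr.
rewrite mulr0 !add0r multi_orth_recurrence_sum//.
rewrite ['X * _]mulrC -mulrA -exprS.
(* Only p = n_i - 1 can leave nonzero terms; there [nn_a] is the quotient that balances the two
   moments. *)
case: eqP => [->|pe]; last by rewrite mop_orth ?subrr//; lia.
have ni : (0 < n i)%N by apply: leq_ltn_trans pn.
by rewrite prednK// moment_nn_a ?subrr.
Qed.

Lemma nn_coeffs_b (a b : table F s) : nn_coeffs mu N a b ->
  forall n j, inbox N (incr n j) -> b n j = nn_b n j.
Proof.
move=> [_ a0 _ rec] n j njN; have nN := inbox_incrW njN.
have /(congr1 (fun P : {poly F} => P`_(weight n))) := rec n j njN.
rewrite !coefD coef_recurrence_sum//; last by move=> k; apply: a0.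
by rewrite coefZ coef_mop// /nn_b => ->; ring.
Qed.

(** The direction [j] makes a recurrence available at [n]; pairing it with mu_i and x^(n_i - 1)
    isolates [a n i]. *)
Lemma nn_coeffs_a (a b : table F s) : nn_coeffs mu N a b ->
  forall n i j, inbox N (incr n j) -> a n i = nn_a n i.
Proof.
move=> [_ a0 _ rec] n i j njN; have nN := inbox_incrW njN.
have [ni|ni] := posnP (n i); first by rewrite a0// /nn_a ni eqxx.
apply: (mulIf (mop_moment_decr_neq0 nN ni)); rewrite moment_nn_a//.
have /(congr1 (fun P => mu i (P * 'X^((n i).-1)))) := rec n j njN.
rewrite !mulrDl !linearD /= -scalerAl linearZ /=.
rewrite mop_orth ?[mu i (mop mu n * 'X^((n i).-1))]mop_orth//; first last.
- by rewrite ffunE; lia.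
- by lia.
rewrite mulr0 !add0r multi_orth_recurrence_sum ?eqxx//; first last.
- by lia.
- by move=> k; apply: a0.
by move=> <-; rewrite ['X * _]mulrC -mulrA -exprS prednK.
Qed.

(** The recurrences at [l] in the two directions share their left side and the sum over [nn_a], so
    both cancel on subtraction. *)
Lemma mop_incrB l j k : inbox N (incr l j) -> inbox N (incr l k) ->
  mop mu (incr l j) - mop mu (incr l k) = (nn_b l k - nn_b l j) *: mop mu l.
Proof.
move=> /mop_recurrence + /mop_recurrence => -> /eqP.
rewrite -subr_eq0 => /eqP e; apply/eqP; rewrite -subr_eq0 -{}[X in _ == X]e.
rewrite scalerBl; apply/eqP; ring.
Qed.

(* If equal, P_(l + e_j) = P_(l + e_k) would be of type II at l + e_j + e_k. *)
Lemma nn_b_neq l j k : j != k -> inbox N (incr (incr l j) k) ->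
  nn_b l k - nn_b l j != 0.
Proof.
move=> jk h; have hj := inbox_incrW h.
have hk : inbox N (incr l k) by move: h; rewrite incrC => /inbox_incrW.
apply: contraNneq (monic_neq0 (let: And3 m _ _ := mopP (norm hj) in m)) => e.
have /eqP := mop_incrB hj hk; rewrite e scale0r subr_eq0 => /eqP ejk.
apply/eqP/(normal_index_eq0 (norm h)).
  by rewrite size_mop// !weight_incr.
move=> i p; have [->|ik] := eqVneq i k; last first.
  by rewrite incr_neq//; apply: mop_orth.
by rewrite incr_id incr_neq 1?eq_sym// ejk -(incr_id l k); apply: mop_orth.
Qed.

(* Both moments in the quotient defining nn_a change by a factor nn_b - nn_b
   when mop_incrB is paired with mu_j. *)
Lemma nn_a_step l j k : j != k -> inbox N (incr (incr l j) k) ->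
  inbox N (incr (incr l j) j) ->
  nn_a (incr (incr l j) k) j =
  nn_a (incr l j) j * (nn_b (incr l j) j - nn_b (incr l j) k)
    / (nn_b l j - nn_b l k).
Proof.
move=> jk hjk hjj; have hj := inbox_incrW hjk.
have hk : inbox N (incr l k) by move: hjk; rewrite incrC => /inbox_incrW.
(* In [M1] and [M2] the subtracted polynomial has the larger j-th index entry, so [mu j] kills its
   product with the chosen power. *)
have M1 : mu j (mop mu (incr (incr l j) k) * 'X^((l j).+1)) =
    (nn_b (incr l j) j - nn_b (incr l j) k)
    * mu j (mop mu (incr l j) * 'X^((l j).+1)).
  have /(congr1 (fun P => mu j (P * 'X^((l j).+1)))) := mop_incrB hjk hjj.
  rewrite mulrBl linearB /= -scalerAl linearZ /= => <-.
  by rewrite [X in _ - X]mop_orth ?subr0// !incr_id.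
have M2 : mu j (mop mu (incr l k) * 'X^(l j)) =
    (nn_b l j - nn_b l k) * mu j (mop mu l * 'X^(l j)).
  have /(congr1 (fun P => mu j (P * 'X^(l j)))) := mop_incrB hk hj.
  rewrite mulrBl linearB /= -scalerAl linearZ /= => <-.
  by rewrite [X in _ - X]mop_orth ?subr0// incr_id.
rewrite /nn_a incr_neq// incr_id /= decr_incr.
rewrite [incr (incr l j) k]incrC decr_incr [incr (incr l k) j]incrC M1 M2 invfM.
ring.
Qed.

(** The neighbours below l + e_j are monic of degree |l|, so at x^|l| each contributes exactly its
    coefficient. *)
Lemma coef_mop_recurrence l j k : inbox N (incr (incr l j) k) ->
  ('X * mop mu (incr l j))`_(weight l) =
  (mop mu (incr (incr l j) k))`_(weight l)
  + nn_b (incr l j) k * (mop mu (incr l j))`_(weight l)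
  + \sum_i nn_a (incr l j) i.
Proof.
move=> h; have hj := inbox_incrW h; rewrite (mop_recurrence h) !coefD coefZ.
congr (_ + _); rewrite coef_sum; apply: eq_bigr => i _; rewrite coefZ.
have [ni|ni] := posnP (incr l j i); first by rewrite /nn_a ni eqxx mul0r.
have -> : weight l = weight (decr (incr l j) i).
  by apply/succn_inj; rewrite -(weight_decr ni) weight_incr.
by rewrite coef_mop ?mulr1// inbox_decr.
Qed.

(** The recurrences at l + e_j in direction k and at l + e_k in direction j both contain
    P_(l+e_j+e_k). Comparing them at x^|l| eliminates it, and [mop_incrB] relates their left
    sides. *)
Lemma nn_b_step l j k : j != k -> inbox N (incr (incr l j) k) ->
  nn_b (incr l k) j =
  nn_b l j + (\sum_i nn_a (incr l k) i - \sum_i nn_a (incr l j) i)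
               / (nn_b l k - nn_b l j).
Proof.
move=> jk h; have d0 := nn_b_neq jk h; have hj := inbox_incrW h.
have h' : inbox N (incr (incr l k) j) by rewrite incrC.
have hk := inbox_incrW h'.
have Rj := coef_mop_recurrence h; have Rk := coef_mop_recurrence h'.
have E : ('X * mop mu (incr l j))`_(weight l) =
    ('X * mop mu (incr l k))`_(weight l)
    + (nn_b l k - nn_b l j) * ('X * mop mu l)`_(weight l).
  rewrite -coefZ scalerAr -mop_incrB// mulrBr coefB; ring.
have bk : nn_b (incr l k) j =
    (mop mu (incr l k))`_(weight l)
    - (mop mu (incr (incr l j) k))`_(weight l).+1.
  by rewrite /nn_b weight_incr coefXM [incr (incr l k) j]incrC.
have bj : nn_b (incr l j) k =
    (mop mu (incr l j))`_(weight l)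
    - (mop mu (incr (incr l j) k))`_(weight l).+1.
  by rewrite /nn_b weight_incr coefXM.
apply: (mulIf d0); rewrite [RHS]mulrDl divfK//.
move: Rj Rk E; rewrite bj bk [incr (incr l k) j]incrC /nn_b.
move=> Rj Rk; rewrite {}Rj {}Rk => E.
move/eqP: E; rewrite -subr_eq0 => /eqP E.
by apply/eqP; rewrite -subr_eq0 -[X in _ == X]E; apply/eqP; ring.
Qed.

(** At the corner of a finite box no recurrence is available and the normalization to 0 decides;
    every other index has a direction inside the box. *)
Lemma nn_coeffs_unique (a b a' b' : table F s) :
  nn_coeffs mu N a b -> nn_coeffs mu N a' b' ->
  (forall n j, inbox N n -> a n j = a' n j) /\
  (forall n j, inbox N (incr n j) -> b n j = b' n j).
Proof.
move=> h h'; split=> [n j nN|n j nN]; last first.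
  by rewrite (nn_coeffs_b h)// (nn_coeffs_b h').
have [hN|[i iN]] := inbox_corner nN.
  by have [_ _ -> // _] := h; have [_ _ -> // _] := h'.
by rewrite (nn_coeffs_a h _ iN) (nn_coeffs_a h' _ iN).
Qed.

End Box.
End TypeIITheory.

(** * Perfect systems and the CC algorithm *)

Section Perfect.
Variables (F : fieldType) (s : nat) (mu : 'I_s -> {scalar {poly F}}).
Variables (N : 'I_s -> bound) (hmu : perfect mu N).
Implicit Types (n l : mindex s) (i j k : 'I_s).

Let norm : forall n, inbox N n -> normal_index mu n := hmu.2.

(** On the axis of [j] the type II conditions involve [mu j] alone, and normality gives uniqueness,
    so both [xget] choices coincide. *)
Lemma mop_on_axis n j : inbox N n -> ~~ off_axis n j ->
  is_monic_op (mu j) (n j) (mop mu n) /\ monic_op (mu j) (n j) = mop mu n.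
Proof.
move=> nN nj; have w := weight_on_axis nj.
have [m1 s1 o1] := mopP (norm nN).
have h : is_monic_op (mu j) (n j) (mop mu n).
  by split=> //; [rewrite s1 w | move=> p; apply: o1].
split=> //; have [m2 s2 o2] :
    [set P | is_monic_op (mu j) (n j) P]%classic (monic_op (mu j) (n j)).
  by apply: xgetPex; exists (mop mu n).
apply/esym/mop_unique => //; rewrite ?w//; first exact: norm.
move=> i p; have [->|ij] := eqVneq i j; first exact: o2.
by rewrite (on_axis_eq0 nj ij).
Qed.

Lemma monic_opP j m : leb_bound m (N j) ->
  is_monic_op (mu j) m (monic_op (mu j) m).
Proof.
move=> mN; pose n : mindex s := [ffun i => if i == j then m else 0%N].
have nN : inbox N n.
  apply/forallP => i; rewrite ffunE; case: eqP => [->//|_].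
  by case: (N i).
have nj : ~~ off_axis n j.
  by apply/existsPn => i; rewrite ffunE; case: eqVneq.
have nE : n j = m by rewrite ffunE eqxx.
by have [h e] := mop_on_axis nN nj; rewrite -nE e.
Qed.

(* A zero at [n j < N j] would make P_n a type II polynomial at n + e_j. *)
Lemma nn_a_eq0 n j : inbox N n ->
  (nn_a mu n j == 0) = (n j == 0%N) || (N j == Some (n j)).
Proof.
move=> nN; rewrite /nn_a; have [nj|nj] := eqVneq (n j) 0%N.
  by rewrite eqxx.
rewrite -lt0n in nj; rewrite mulf_eq0 invr_eq0.
rewrite (negPf (mop_moment_decr_neq0 norm nN nj)) orbF /=.
apply/eqP/eqP => [|Nj].
  move=> e; apply: contrapT => /(inbox_incr nN) njN.
  by have /eqP := mop_moment_neq0 (norm nN) (norm njN).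
(* Conversely, if n_j = N_j, then P_n is a multiple of the last orthogonal polynomial of [mu j], so
   the numerator of [nn_a] vanishes. *)
have hL := hmu.1 j; rewrite Nj in hL.
have hP : is_monic_op (mu j) (n j) (monic_op (mu j) (n j)).
  by apply: monic_opP; rewrite Nj /=.
have oP : multi_orth mu n (mop mu n) by apply: (mop_orth norm).
have /dvdpP[Q ->] := calL_last_op_dvdp hL hP (oP j).
by rewrite [Q * _]mulrC -mulrA (calL_last_op hL hP).
Qed.

Variables aJ bJ : 'I_s -> nat -> F.
Hypothesis hJ : forall j, jacobi_coeffs (mu j) (N j) (aJ j) (bJ j).

Lemma jacobi_on_axis n j : inbox N (incr n j) -> ~~ off_axis n j ->
  'X * mop mu n = mop mu (incr n j) + bJ j (n j) *: mop mu n
                  + aJ j (n j) *: mop mu (decr n j).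
Proof.
move=> njN nj; have nN := inbox_incrW njN.
have nji : ~~ off_axis (incr n j) j.
  apply/existsPn => i; have [//|ij] := eqVneq i j.
  by rewrite incr_neq// (on_axis_eq0 nj ij).
have njd : ~~ off_axis (decr n j) j.
  apply/existsPn => i; have [//|ij] := eqVneq i j.
  by rewrite decr_neq// (on_axis_eq0 nj ij).
have [_ <-] := mop_on_axis nN nj; have [_ <-] := mop_on_axis njN nji.
have [_ <-] := mop_on_axis (inbox_decr j nN) njd.
rewrite incr_id decr_id; have [_ _] := hJ j; apply.
by have /forallP/(_ j) := njN; rewrite incr_id.
Qed.

Lemma jacobi_b n j : inbox N (incr n j) -> ~~ off_axis n j ->
  bJ j (n j) = nn_b mu n j.
Proof.
move=> njN nj; have nN := inbox_incrW njN.
rewrite /nn_b (jacobi_on_axis njN nj) !coefD !coefZ (coef_mop norm)//.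
suff -> : aJ j (n j) * (mop mu (decr n j))`_(weight n) = 0 by ring.
have [nj0|nj0] := posnP (n j).
  by have [a0 _ _] := hJ j; rewrite nj0 a0 mul0r.
rewrite nth_default ?mulr0// (size_mop norm) ?inbox_decr//.
by rewrite -(weight_decr nj0).
Qed.

(** At n_j = N_j both sides are 0. For 0 < n_j < N_j the Jacobi and nearest neighbour recurrences
    differ only in the coefficient of P_(n-e_j), which is nonzero. *)
Lemma jacobi_a n j : inbox N n -> ~~ off_axis n j -> aJ j (n j) = nn_a mu n j.
Proof.
move=> nN nj; have [aJ0 aJN _] := hJ j.
have [nj0|nj0] := posnP (n j); first by rewrite nj0 aJ0 /nn_a nj0.
have [Nj|Nj] := eqVneq (N j) (Some (n j)).
  by rewrite (aJN _ Nj); apply/esym/eqP; rewrite nn_a_eq0// Nj eqxx orbT.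
have njN : inbox N (incr n j) by apply: inbox_incr => //; apply/eqP.
have /eqP := jacobi_on_axis njN nj.
rewrite (mop_recurrence norm njN) jacobi_b// (inj_eq (addrI _)).
rewrite (bigD1 j)//= big1 ?addr0 => [|i ij]; last first.
  by rewrite /nn_a (on_axis_eq0 nj ij) eqxx scale0r.
rewrite -subr_eq0 -scalerBl scaler_eq0 subr_eq0 => /orP[/eqP//|/eqP e].
by have := size_mop norm (inbox_decr j nN); rewrite e size_poly0.
Qed.

(** * Correctness of the stages of the CC algorithm *)

Variables sela selb : mindex s -> 'I_s -> 'I_s.
Hypotheses (hsela : selector sela) (hselb : selector selb).

(** The disjunction lists the entries already final: those of earlier stages, and those the step
    never writes because they lie on an axis or have n_j = 0. *)
Lemma cc_step1_correct d (a b : table F s) :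
  (forall n j, inbox N n ->
     [|| (weight n < d)%N, ~~ off_axis n j | n j == 0%N] ->
     a n j = nn_a mu n j) ->
  (forall n j, inbox N (incr n j) -> (weight n < d)%N -> b n j = nn_b mu n j) ->
  forall n j, inbox N n ->
    [|| (weight n < d.+1)%N, ~~ off_axis n j | n j == 0%N] ->
    cc_step1 N sela d a b n j = nn_a mu n j.
Proof.
move=> ha hb n j nN; rewrite ltnS leq_eqVlt -orbA /cc_step1 nN /=.
case: ifP => [/and3P[/eqP wn nj0 off] _|]; last first.
  move=> cF h; apply: ha => //; move: cF h.
  case: (weight n == d) => //=; rewrite lt0n.
  by case: (n j == 0%N); case: (off_axis n j); rewrite ?orbT.
have [kj nk0] := hsela off; move: (sela n j) kj nk0 => k kj nk0.
have [l nE] : exists l, n = incr (incr l j) k.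
  by exists (decr (decr n k) j); rewrite !incr_decr// decr_neq// eq_sym.
have jk : j != k by rewrite eq_sym.
rewrite {n nk0 nj0 off}nE in wn nN *; rewrite !decr_incr.
have lj := inbox_incrW nN.
have lk : inbox N (incr l k) by move: nN; rewrite incrC => /inbox_incrW.
have wl : ((weight l).+1 < d)%N by rewrite -wn !weight_incr.
rewrite ha ?weight_incr ?wl// nn_a_eq0//.
(* The zero test detects n_j = N_j, which adding e_k does not affect. If it fails, l + 2e_j is in
   the box, as [nn_a_step] requires. *)
case: ifP => [e|/negbT].
  by apply/esym/eqP; rewrite nn_a_eq0// incr_neq.
rewrite negb_or => /andP[_ /eqP/(inbox_incr lj) ljj].
by rewrite /delta !hb ?weight_incr ?(ltnW wl)// (nn_a_step norm).
Qed.

(** Both sums are over entries of [a] of weight [d], final after step (1); the entries of [b] that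
    are read have weight [d - 1]. *)
Lemma cc_step2_correct d (a b : table F s) :
  (forall n j, inbox N n -> (weight n < d.+1)%N -> a n j = nn_a mu n j) ->
  (forall n j, inbox N (incr n j) -> (weight n < d)%N || ~~ off_axis n j ->
     b n j = nn_b mu n j) ->
  forall n j, inbox N (incr n j) -> (weight n < d.+1)%N || ~~ off_axis n j ->
    cc_step2 N selb d a b n j = nn_b mu n j.
Proof.
move=> ha hb n j nN; rewrite ltnS leq_eqVlt -orbA /cc_step2 nN /=.
case: ifP => [/andP[/eqP wn off] _|]; last first.
  move=> cF h; apply: hb => //; move: cF h.
  by case: (weight n == d) => //= ->; rewrite orbT.
have [kj nk0] := hselb off; move: (selb n j) kj nk0 => k kj nk0.
have nE : n = incr (decr n k) k by rewrite incr_decr.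
rewrite decr_incrC//; move: (decr n k) nE => l nE.
move: nN wn; rewrite {n nk0 off}nE weight_incr => nN wl.
have ljk : inbox N (incr (incr l j) k) by rewrite incrC.
have lj := inbox_incrW ljk; have lk := inbox_incrW nN.
have ld : (weight l < d)%N by rewrite -wl.
rewrite /delta !hb ?ld// (nn_b_step norm _ ljk) 1?eq_sym//.
congr (_ + (_ - _) / _); apply: eq_bigr => i _; rewrite ha// weight_incr ltnS//.
Qed.

Lemma cc_tables_correct d :
  (forall n j, inbox N n ->
     [|| (weight n < d)%N, ~~ off_axis n j | n j == 0%N] ->
     (cc_tables N aJ bJ sela selb d).1 n j = nn_a mu n j) /\
  (forall n j, inbox N (incr n j) -> (weight n < d)%N || ~~ off_axis n j ->
     (cc_tables N aJ bJ sela selb d).2 n j = nn_b mu n j).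
Proof.
elim: d => [|d [IHa IHb]].
  split=> n j nN /=; last by move=> on; rewrite /cc_init_b on jacobi_b.
  rewrite /cc_init_a; have [nj0 _|nj0] := posnP (n j).
    by rewrite /nn_a nj0.
  by rewrite orbF => on; rewrite on jacobi_a.
move: IHa IHb; rewrite /=; case: (cc_tables _ _ _ _ _ d) => a b /= IHa IHb.
have IHb' n j : inbox N (incr n j) -> (weight n < d)%N -> b n j = nn_b mu n j.
  by move=> nN wn; apply: IHb; rewrite ?wn.
have step1 := cc_step1_correct IHa IHb'.
split=> //; apply: cc_step2_correct => // n j nN wn.
by apply: step1; rewrite ?wn.
Qed.

Lemma cc_aE n j : inbox N n -> cc_a N aJ bJ sela selb n j = nn_a mu n j.
Proof. by move=> nN; apply: (cc_tables_correct _).1; rewrite ?ltnSn. Qed.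

Lemma cc_bE n j : inbox N (incr n j) ->
  cc_b N aJ bJ sela selb n j = nn_b mu n j.
Proof. by move=> nN; apply: (cc_tables_correct _).2; rewrite ?ltnSn. Qed.

Lemma delta_cc_b_neq0 l j k : j != k -> inbox N (incr (incr l j) k) ->
  delta (cc_b N aJ bJ sela selb) l j k != 0.
Proof.
move=> jk h; have h' := h; rewrite incrC in h'.
rewrite /delta !cc_bE ?(inbox_incrW h) ?(inbox_incrW h')//.
exact: (nn_b_neq norm jk h).
Qed.

(** Each divisor is a difference at some l with l + e_j + e_k in the box: this sum is n in step (1)
    and n + e_j in step (2). *)
Lemma cc_no_div0_perfect : cc_no_div0 N aJ bJ sela selb.
Proof.
split=> [n j k jk nN nj nk _|n j k jk nN nk]; apply: delta_cc_b_neq0 => //.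
- by rewrite eq_sym.
- rewrite incrC incr_decr ?incr_decr//.
  by rewrite decr_neq.
by rewrite incrC incr_decr.
Qed.

End Perfect.

(** * The Christoffel transform *)

Section MiRcons.
Variables (s m : nat).
Implicit Types (k : mindex s) (j : 'I_s).

Lemma mi_rcons_lift k j : mi_rcons k m (lift ord_max j) = k j.
Proof. by rewrite ffunE liftK. Qed.

Lemma mi_rcons_max k : mi_rcons k m ord_max = m.
Proof. by rewrite ffunE unlift_none. Qed.

Lemma incr_mi_rcons k j :
  incr (mi_rcons k m) (lift ord_max j) = mi_rcons (incr k j) m.
Proof.
apply/ffunP => i; rewrite !ffunE; case: unliftP => [i' ->|->].
  by rewrite ffunE (inj_eq lift_inj).
by rewrite (negPf (neq_lift _ _)) addn0.
Qed.

Lemma decr_mi_rcons k j :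
  decr (mi_rcons k m) (lift ord_max j) = mi_rcons (decr k j) m.
Proof.
apply/ffunP => i; rewrite !ffunE; case: unliftP => [i' ->|->].
  by rewrite ffunE (inj_eq lift_inj).
by rewrite (negPf (neq_lift _ _)) subn0.
Qed.

Lemma weight_mi_rcons k : weight (mi_rcons k m) = (m + weight k)%N.
Proof.
rewrite /weight (bigD1_ord ord_max)//= mi_rcons_max; congr addn.
by apply: eq_bigr => j _; rewrite mi_rcons_lift.
Qed.

Lemma inbox_mi_rcons (N : 'I_s.+1 -> bound) k : N ord_max = Some m ->
  inbox N (mi_rcons k m) = inbox (fun j => N (lift ord_max j)) k.
Proof.
move=> hm; apply/forallP/forallP => h j.
  by have := h (lift ord_max j); rewrite mi_rcons_lift.
case: (unliftP ord_max j) => [i|] ->; first by rewrite mi_rcons_lift.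
by rewrite mi_rcons_max hm /=.
Qed.

End MiRcons.

Section ChristoffelTransform.
Variables (F : fieldType) (s : nat) (mu : 'I_s.+1 -> {scalar {poly F}}).
Variables (N : 'I_s.+1 -> bound) (m : nat).
Hypotheses (hmu : perfect mu N) (hm : N ord_max = Some m).

Let Phi := monic_op (mu ord_max) m.
Let nuhat : 'I_s -> {scalar {poly F}} :=
  fun j => mul_functional Phi (mu (lift ord_max j)).
Let K : 'I_s -> bound := fun j => N (lift ord_max j).
Let norm : forall n, inbox N n -> normal_index mu n := hmu.2.

Lemma last_monic_opP : is_monic_op (mu ord_max) m Phi.
Proof. by apply: (monic_opP hmu); rewrite hm /=. Qed.

(** For the first functionals this unfolds [nuhat]; the last one vanishes on all multiples of
    [Phi]. *)
Lemma multi_orth_mi_rcons k Q : multi_orth nuhat k Q ->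
  multi_orth mu (mi_rcons k m) (Phi * Q).
Proof.
move=> oQ j p; case: (unliftP ord_max j) => [i|] ->.
  by rewrite mi_rcons_lift -mulrA => /oQ.
move=> _; rewrite -mulrA; apply: (calL_last_op _ last_monic_opP).
by rewrite -hm; apply: hmu.1.
Qed.

Lemma size_mul_Phi Q : Q != 0 -> size (Phi * Q) = (m + size Q)%N.
Proof.
have [mPhi sPhi _] := last_monic_opP => Q0.
by rewrite size_monicM ?sPhi.
Qed.

(** Multiplication by [Phi] raises degree and weight alike by [m], so normality descends from (k,
    m). *)
Lemma normal_nuhat k : inbox K k -> normal_index nuhat k.
Proof.
move=> kK Q [Q0 sQ oQ].
have [mPhi _ _] := last_monic_opP.
have : size (Phi * Q) = (weight (mi_rcons k m)).+1.
  apply: norm; first by rewrite inbox_mi_rcons.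
  split; last exact: multi_orth_mi_rcons.
    by rewrite mulf_neq0// monic_neq0.
  by rewrite size_mul_Phi// weight_mi_rcons -addnS leq_add2l.
by rewrite size_mul_Phi// weight_mi_rcons -addnS => /addnI.
Qed.

Lemma mop_mi_rcons k : inbox K k ->
  mop mu (mi_rcons k m) = Phi * mop nuhat k.
Proof.
move=> kK; have [mh sh oh] := mopP (normal_nuhat kK).
have [mPhi _ _] := last_monic_opP.
apply: mop_unique; first by apply: norm; rewrite inbox_mi_rcons.
- by rewrite monicMl.
- by rewrite size_mul_Phi ?monic_neq0// weight_mi_rcons sh addnS.
exact: multi_orth_mi_rcons.
Qed.

Lemma nn_coeffs_nuhat : nn_coeffs nuhat K
  (fun k j => nn_a mu (mi_rcons k m) (lift ord_max j))
  (fun k j => nn_b mu (mi_rcons k m) (lift ord_max j)).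
Proof.
have [mPhi _ _] := last_monic_opP.
split.
- exact: normal_nuhat.
- by move=> k j kK kj; rewrite /nn_a mi_rcons_lift kj.
- move=> k hk j; apply/eqP; rewrite (nn_a_eq0 hmu); last first.
    by rewrite inbox_mi_rcons//; apply/forallP => i; rewrite -/(K i) hk /=.
  by rewrite mi_rcons_lift -hk /K eqxx orbT.
move=> k j kjK; have kK := inbox_incrW kjK.
have kN : inbox N (mi_rcons k m) by rewrite inbox_mi_rcons.
have kjN : inbox N (incr (mi_rcons k m) (lift ord_max j)).
  by rewrite incr_mi_rcons inbox_mi_rcons.
apply: (mulfI (monic_neq0 mPhi)); rewrite mulrCA -mop_mi_rcons//.
rewrite (mop_recurrence norm kjN) incr_mi_rcons !mulrDr -mop_mi_rcons//.
rewrite -scalerAr -mop_mi_rcons//; congr (_ + _).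
rewrite (bigD1_ord ord_max)//=.
(* This removes the term at (k, m - 1), the only one not covered by [mop_mi_rcons]. *)
have /eqP -> : nn_a mu (mi_rcons k m) ord_max == 0.
  by rewrite (nn_a_eq0 hmu)// hm mi_rcons_max eqxx orbT.
rewrite scale0r add0r mulr_sumr; apply: eq_bigr => i _.
by rewrite -scalerAr -mop_mi_rcons ?inbox_decr// decr_mi_rcons.
Qed.

End ChristoffelTransform.

Theorem corollary3p9 (R : realType) (s : nat) (hs : (0 < s)%N)
    (mu : 'I_s.+1 -> {scalar {poly complex R}})
    (N : 'I_s.+1 -> bound) (m : nat)
    (hmu : perfect mu N) (hm : N ord_max = Some m)
    (aJ bJ : 'I_s.+1 -> nat -> complex R)
    (hJ : forall j, jacobi_coeffs (mu j) (N j) (aJ j) (bJ j))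
    (sela selb : mindex s.+1 -> 'I_s.+1 -> 'I_s.+1)
    (hsela : selector sela) (hselb : selector selb) :
  let Phi : {poly complex R} := monic_op (mu ord_max) m in
  let nuhat : 'I_s -> {scalar {poly complex R}} :=
    fun j => mul_functional Phi (mu (lift ord_max j)) in
  let K : 'I_s -> bound := fun j => N (lift ord_max j) in
  let a := cc_a N aJ bJ sela selb in
  let b := cc_b N aJ bJ sela selb in
  [/\ cc_no_div0 N aJ bJ sela selb,
      exists ahat bhat, nn_coeffs nuhat K ahat bhat
    & forall ahat bhat, nn_coeffs nuhat K ahat bhat ->
        (forall (k : mindex s) (j : 'I_s), inbox K k ->
           ahat k j = a (mi_rcons k m) (lift ord_max j)) /\
        (forall (k : mindex s) (j : 'I_s), inbox K (incr k j) ->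
           bhat k j = b (mi_rcons k m) (lift ord_max j))].
Proof.
move=> Phi nuhat K a b; have hnn := nn_coeffs_nuhat hmu hm; split.
- exact: (cc_no_div0_perfect hmu hJ hsela hselb).
- by do 2 eexists; exact: hnn.
move=> ahat bhat h.
have [ea eb] := nn_coeffs_unique (normal_nuhat hmu hm) h hnn.
split=> k j kK.
  by rewrite /a (cc_aE hmu hJ hsela hselb) ?inbox_mi_rcons// ea.
rewrite /b (cc_bE hmu hJ hsela hselb) ?eb//.
by rewrite incr_mi_rcons inbox_mi_rcons.
Qed.
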